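(* There is an adjoint string $$\Pi\dashv\flat\dashv\natural\dashv\sharp\dashv\Lambda,\qquad \Pi,\natural,\Lambda:\mathbf{SSS}\to\mathbf{QUS},\quad \flat,\sharp:\mathbf{QUS}\to\mathbf{SSS},$$ in which $\flat$ and $\sharp$ are full and faithful and $\Pi$ preserves finite products. In particular $\mathbf{SSS}$ is cohesive over $\mathbf{QUS}$ in the sense of Lawvere, with the additional right adjoint $\Lambda$.
   Context: **Sample space.** $\Omega=[0,1]^{\mathbb{N}}$; $\mathcal{B}_\Omega$ is the universal completion of its Borel (product) $\sigma$-algebra, i.e. all universally measurable subsets; $\Omega^\Omega$ is the set of all $\mathcal{B}_\Omega$-$\mathcal{B}_\Omega$-measurable self-maps of $\Omega$. **Quasi-universal spaces.** A quasi-universal space is a set $\mathcal{S}$ with a set $\mathcal{S}^\Omega$ of maps $\Omega\to\mathcal{S}$ containing all constants and closed under precomposition with elements of $\Omega^\Omega$; morphisms $g:\mathcal{S}\to\mathcal{T}$ of $\mathbf{QUS}$ are maps with $g\circ X\in\mathcal{T}^\Omega$ for all $X\in\mathcal{S}^\Omega$. Products: $(\prod_i\mathcal{S}_i)^\Omega=\prod_i\mathcal{S}_i^\Omega$. $\Omega$ itself is a quasi-universal space with random variables $\Omega^\Omega$. **Site.** $\Omega_n:=\mathbb{R}^n\times\Omega$, $n\ge0$ ($\Omega_0=\Omega$). A map $g:\Omega_m\to\mathbb{R}^n$ is mixed-smooth, $g\in\mathcal{C}^\infty_{\mathrm{mix}}(\Omega_m,\mathbb{R}^n)$, if (M1) $g(-,\omega)\in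 C^\infty(\mathbb{R}^m,\mathbb{R}^n)$ for every $\omega$, and (M2) $g(t,-)$ is $\mathcal{B}_\Omega$-Borel measurable for every $t$. The category $\mathbb{S}$ has objects $\Omega_n$ and morphisms $\mathbb{S}(\Omega_m,\Omega_n)=\{(g,\Phi): g\in\mathcal{C}^\infty_{\mathrm{mix}}(\Omega_m,\mathbb{R}^n),\Phi\in\Omega^\Omega\}$, where $(g,\Phi)(t,\omega)=(g(t,\omega),\Phi(\omega))$. Write $\pi_n:\Omega_n\to\Omega_0$, $\pi_n(t,\omega)=\omega$. **Sample-smooth spaces.** A sample-smooth space is a set $\mathcal{X}$ with, for each $n\ge0$, a set $\mathcal{X}^{\Omega_n}$ of maps $\Omega_n\to\mathcal{X}$ (plots) containing all constant maps and such that $p\in\mathcal{X}^{\Omega_n}$, $h\in\mathbb{S}(\Omega_m,\Omega_n)$ imply $p\circ h\in\mathcal{X}^{\Omega_m}$. A map $f:\mathcal{X}\to\mathcal{Y}$ is sample-smooth (a morphism of $\mathbf{SSS}$) if $f\circ p\in\mathcal{Y}^{\Omega_n}$ for all $n$ and $p\in\mathcal{X}^{\Omega_n}$. Write $\mathcal{X}^\Omega:=\mathcal{X}^{\Omega_0}$. Products: $(\prod_i\mathcal{X}_i)^{\Omega_n}=\prod_i\mathcal{X}_i^{\Omega_n}$. **The functors.** - $\natural\mathcal{X}:=(\mathcal{X},\mathcal{X}^\Omega)$. - $\flat\mathcal{S}$: the set $\mathcal{S}$ with $(\flat\mathcal{S})^{\Omega_n}:=\{X\circ\pi_n: X\in\mathcal{S}^\Omega\}$.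 - $\sharp\mathcal{S}$: the set $\mathcal{S}$ with $(\sharp\mathcal{S})^{\Omega_n}:=\{p:\Omega_n\to\mathcal{S}: p\circ h\in\mathcal{S}^\Omega\ \forall h\in\mathbb{S}(\Omega_0,\Omega_n)\}$. - $\Lambda\mathcal{X}:=(\mathcal{X},\mathbf{SSS}(\sharp\Omega,\mathcal{X}))$, a sample-smooth map $\sharp\Omega\to\mathcal{X}$ being read as a map $\Omega\to\mathcal{X}$. - $\Pi\mathcal{X}:=\mathcal{X}/\!\sim$, where $\sim$ is the equivalence relation generated by $p(t,\omega)\sim p(t',\omega)$ for $p\in\mathcal{X}^{\Omega_1}$, $t,t'\in\mathbb{R}$, $\omega\in\Omega$, with the final quasi-universal structure along the projection $q_{\mathcal{X}}:\natural\mathcal{X}\to\Pi\mathcal{X}$, i.e. $(\Pi\mathcal{X})^\Omega=q_{\mathcal{X}}\circ\mathcal{X}^\Omega$ for $\mathcal{X}$ non-empty. On morphisms $\natural,\flat,\sharp,\Lambda$ act as the identity on underlying maps and $\Pi$ by the induced map on quotients. ''Cohesive over $\mathbf{QUS}$'' means that there is an adjoint string $\Pi\dashv\flat\dashv\natural\dashv\sharp$ with $\flat,\sharp$ full and faithful and $\Pi$ preserving finite products. *)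

(* Defs.v *)
From HB Require Import structures.
From Stdlib Require Import Relations.
From mathcomp Require Import all_boot all_order all_algebra.
From mathcomp Require Import all_classical all_reals all_analysis.
From mathcomp Require Import measurable_realfun.

Set Implicit Arguments.
Unset Strict Implicit.
Unset Printing Implicit Defensive.
Import Order.TTheory GRing.Theory Num.Theory.
Import numFieldNormedType.Exports.

Local Open Scope classical_set_scope.
Local Open Scope ring_scope.

Record category := Category {
  Ob :> Type;
  Hom : Ob -> Ob -> Type;
  idc : forall a, Hom a a;
  compc : forall a b c, Hom b c -> Hom a b -> Hom a c;
  compc1l : forall a b (f : Hom a b), compc (idc b) f = f;
  compc1r : forall a b (f : Hom a b), compc f (idc a) = f;
  compcA : forall a b c d (h : Hom c d) (g : Hom b c) (f : Hom a b),
    compc h (compc g f) = compc (compc h g) f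
}.
Arguments Hom {_}.
Arguments idc {_}.
Arguments compc {_ _ _ _}.

Record functor (C D : category) := Functor {
  fob :> C -> D;
  fmap : forall a b : C, Hom a b -> Hom (fob a) (fob b);
  fmap1 : forall a : C, fmap (idc a) = idc (fob a);
  fmapM : forall (a b c : C) (g : Hom b c) (f : Hom a b),
    fmap (compc g f) = compc (fmap g) (fmap f)
}.
Arguments fmap {_ _} _ {_ _}.

Definition full (C D : category) (F : functor C D) : Prop :=
  forall (a b : C) (g : Hom (F a) (F b)), exists f : Hom a b, fmap F f = g.

Definition faithful (C D : category) (F : functor C D) : Prop :=
  forall a b : C, injective (@fmap C D F a b).

(* F -| G, by a bijection of hom-sets natural in both arguments *)
Definition adjoint (C D : category) (F : functor C D) (G : functor D C) : Prop :=
  exists phi : forall (c : C) (d : D), Hom (F c) d -> Hom c (G d),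
    (forall c d, bijective (phi c d)) /\
    (forall (c c' : C) (d d' : D)
       (u : Hom c' c) (v : Hom d d') (f : Hom (F c) d),
       phi c' d' (compc v (compc f (fmap F u))) =
       compc (fmap G v) (compc (phi c d f) u)).

Definition is_product (C : category) (I : Type) (X : I -> C)
    (P : C) (pr : forall i, Hom P (X i)) : Prop :=
  forall (Q : C) (f : forall i, Hom Q (X i)),
    exists! h : Hom Q P, forall i, compc (pr i) h = f i.

Definition preserves_finite_products (C D : category) (F : functor C D) : Prop :=
  forall (I : finType) (X : I -> C) (P : C) (pr : forall i, Hom P (X i)),
    is_product pr -> is_product (X := fun i => F (X i)) (fun i => fmap F (pr i)).

Definition cohesive_over (E S : category) : Prop :=
  exists (Pi : functor E S) (flat : functor S E)
         (nat : functor E S) (sharp : functor S E),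
    [/\ adjoint Pi flat, adjoint flat nat & adjoint nat sharp] /\
    [/\ full flat, faithful flat, full sharp & faithful sharp] /\
    preserves_finite_products Pi.

Definition Omega (R : realType) := {w : nat -> R | forall k, 0 <= w k <= 1}.

Section sample_space.
Variable R : realType.
Local Notation Omega := (Omega R).

Lemma Omega0_subproof (k : nat) : 0 <= (0 : R) <= 1.
Proof. by rewrite lexx ler01. Qed.

HB.instance Definition _ := gen_eqMixin Omega.
HB.instance Definition _ := gen_choiceMixin Omega.
HB.instance Definition _ :=
  isPointed.Build Omega (exist _ (fun _ => 0) Omega0_subproof).

Definition omega_cylinder : set (set Omega) :=
  [set A | exists k (B : set R), measurable B /\ A = [set w | B (sval w k)]].

Definition borelOmega := g_sigma_algebraType omega_cylinder.

Definition universally_measurable : set (set Omega) :=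
  [set A | forall P : probability borelOmega R, completed_algebra_gen P A].

Lemma universally_measurable0 : universally_measurable set0.
Proof.
move=> P; exists set0; first exact: measurable0.
by exists set0; [exact: negligible_set0 | rewrite setU0].
Qed.

Lemma universally_measurableC A :
  universally_measurable A -> universally_measurable (~` A).
Proof.
move=> mA P; have [B mB [N [M [mM M0 NM]] <-{A mA}]] := mA P.
exists (~` (B `|` M)); first by apply: measurableC; exact: measurableU.
exists (M `&` ~` (B `|` N)).
  by apply: negligibleS (@subIsetl _ M _) _; exists M; split.
apply/seteqP; split=> [w /= [BM [Bw|Nw]|[Mw //]]|w /= BN].
- by apply: BM; left.
- by apply: BM; right; exact: NM.
- have [Mw|nMw] := pselect (M w); first by right; split.
  by left=> -[Bw|//]; apply: BN; left.
Qed.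

Lemma universally_measurable_bigcup (F : (set Omega)^nat) :
  (forall i, universally_measurable (F i)) ->
  universally_measurable (\bigcup_i F i).
Proof.
move=> mF P.
have /choice[B HB] : forall i, exists B : set borelOmega,
    measurable B /\ exists2 N, P.-negligible N & B `|` N = F i.
  by move=> i; have [B mB [N N0 E]] := mF i P; exists B; split => //; exists N.
have /choice[N HN] : forall i, exists N : set borelOmega,
    P.-negligible N /\ B i `|` N = F i.
  by move=> i; have [_ [N N0 E]] := HB i; exists N.
exists (\bigcup_i B i).
  by apply: bigcupT_measurable => i; have [] := HB i.
exists (\bigcup_i N i).
  by apply: negligible_bigcup => i; have [] := HN i.
by rewrite -bigcupU; apply: eq_bigcupr => i _; have [] := HN i.
Qed.

Fact universal_display : measure_display. Proof. exact: default_measure_display. Qed.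

(* From here on, measurability on Omega refers to the universal completion. *)
HB.instance Definition _ := @isMeasurable.Build universal_display Omega
  universally_measurable universally_measurable0
  universally_measurableC universally_measurable_bigcup.

End sample_space.

(* C^k: all iterated partial derivatives up to order k exist and are
   continuous. *)
Fixpoint is_Ck (R : realType) (m n : nat) (k : nat)
    (f : 'rV[R]_m -> 'rV[R]_n) {struct k} : Prop :=
  match k with
  | 0%N => continuous f
  | k'.+1 => continuous f /\
      forall i : 'I_m,
        (forall x, derivable f x (delta_mx 0 i)) /\
        is_Ck k' (fun x => 'D_(delta_mx 0 i) f x)
  end.

Definition smooth (R : realType) (m n : nat) (f : 'rV[R]_m -> 'rV[R]_n) : Prop :=
  forall k, is_Ck k f.

Definition borelV (R : realType) (n : nat) :=
  g_sigma_algebraType (@open 'rV[R]_n).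

Definition Omega_ (R : realType) (n : nat) : Type := ('rV[R]_n * Omega R)%type.

Definition mixed_smooth (R : realType) (m n : nat)
    (g : Omega_ R m -> 'rV[R]_n) : Prop :=
  (forall w, smooth (fun t => g (t, w))) /\
  (forall t, measurable_fun setT ((fun w => g (t, w)) : Omega R -> borelV R n)).

Definition site_map (R : realType) (m n : nat)
    (g : Omega_ R m -> 'rV[R]_n) (Phi : Omega R -> Omega R) :
    Omega_ R m -> Omega_ R n :=
  fun tw => (g tw, Phi tw.2).

Definition site_hom (R : realType) (m n : nat) : set (Omega_ R m -> Omega_ R n) :=
  [set h | exists g Phi,
    [/\ mixed_smooth g, measurable_fun setT Phi & h = site_map g Phi]].
Arguments site_hom : clear implicits.

Definition site_pi (R : realType) (n : nat) : Omega_ R n -> Omega R := snd.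
Arguments site_pi : clear implicits.

(* Omega_0 = R^0 x Omega is identified with Omega: [site_pi R 0] is the
   identification and [site_pt] its inverse. *)
Definition site_pt (R : realType) : Omega R -> Omega_ R 0 := fun w => (0, w).

Section caratheodory.
Variables (R : realType) (m n : nat).
Variable (g : Omega_ R m -> 'rV[R]_n).
Hypothesis gc : forall w, continuous (fun t => g (t, w)).
Hypothesis gm :
  forall t, measurable_fun setT ((fun w => g (t, w)) : Omega R -> borelV R n).
Variables (a : Omega R -> borelV R m) (Phi : Omega R -> Omega R).
Hypothesis am : measurable_fun setT a.
Hypothesis Phim : measurable_fun setT Phi.

Let q (r : 'rV[rat]_m) : 'rV[R]_m := map_mx ratr r.

Let q_dense (x : 'rV[R]_m) (e : R) : 0 < e -> exists r, ball x e (q r).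
Proof.
move=> e0.
have /choice[r Hr] : forall i, exists s : rat, ball (x 0 i) e (ratr s : R).
  move=> i; have : (x 0 i - e < x 0 i)%R by rewrite ltrBlDr ltrDl.
  move=> /rat_in_itvoo[s]; rewrite in_itv /= => /andP[s1 s2].
  exists s; rewrite /ball /= ger0_norm; last by rewrite subr_ge0 ltW.
  by rewrite ltrBlDr addrC -ltrBlDr.
exists (\row_i r i); rewrite /ball /=; split => // i j.
by rewrite ord1 /q !mxE; exact: Hr.
Qed.

Let inv_gt0 (k : nat) : 0 < k.+1%:R^-1 :> R.
Proof. by rewrite invr_gt0. Qed.

(* the points at distance at least 1/(j+1) from the complement of U *)
Let inner (U : set 'rV[R]_n) (j : nat) : set 'rV[R]_n :=
  ~` \bigcup_(y in ~` U) ball y j.+1%:R^-1.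

Let measurable_inner U j (h : Omega R -> borelV R n) :
  measurable_fun setT h -> measurable [set w | inner U j (h w)].
Proof.
move=> hm; rewrite -[X in measurable X]setTI; apply: (hm measurableT).
apply: measurableC; apply: sub_sigma_algebra.
by apply: bigcup_open => y _; exact: ball_open.
Qed.

Let gnear w (e : R) : 0 < e -> exists2 d : R, 0 < d &
  forall t, ball (a w : 'rV[R]_m) d t ->
    ball (g (a w, Phi w)) e (g (t, Phi w)).
Proof.
move=> e0.
have : nbhs (a w : 'rV[R]_m)
    ((fun t => g (t, Phi w)) @^-1` ball (g (a w, Phi w)) e).
  by apply: (gc (w := Phi w) (x := a w)); exact: nbhsx_ballx.
by move=> /nbhs_ballP[d /= d0 H]; exists d.
Qed.

Let cellE (U : set 'rV[R]_n) : open U ->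
  [set w | U (g (a w, Phi w))] =
  \bigcup_j \bigcup_k \bigcap_(r in [set: 'rV[rat]_m])
    (~` [set w | ball (q r) k.+1%:R^-1 (a w : 'rV[R]_m)] `|`
     [set w | inner U j (g (q r, Phi w))]).
Proof.
move=> oU; apply/seteqP; split=> [w /= Uw|w [j _ [k _]] /= H].
- have /nbhs_ballP[e /= e0 eU] : nbhs (g (a w, Phi w)) U.
    by apply: open_nbhs_nbhs.
  have e20 : 0 < e / 2 by rewrite divr_gt0.
  have [j _ je] : exists2 j : nat, True & j.+1%:R^-1 < e / 2.
    by have [j _ /(_ j (leqnn j)) ?] := near_infty_natSinv_lt (PosNum e20); exists j.
  have [d d0 dg] := gnear w e20.
  have [k _ kd] : exists2 k : nat, True & k.+1%:R^-1 < d.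
    by have [k _ /(_ k (leqnn k)) ?] := near_infty_natSinv_lt (PosNum d0); exists k.
  exists j => //; exists k => // r _ /=.
  have [kr|] := pselect (ball (q r) k.+1%:R^-1 (a w : 'rV[R]_m)); last by left.
  right=> -[y /= nUy yj]; apply: nUy; apply: eU.
  have gr : ball (g (a w, Phi w)) (e / 2) (g (q r, Phi w)).
    by apply: dg; apply: ball_sym; exact: le_ball (ltW kd) _ kr.
  rewrite (splitr e); apply: ball_triangle gr _.
  by apply: ball_sym; exact: le_ball (ltW je) _ yj.
- apply: contrapT => nU.
  have [d d0 dg] := gnear w (inv_gt0 j).
  have m0 : 0 < Num.min d k.+1%:R^-1 by rewrite lt_min d0 inv_gt0.
  have [r rb] := q_dense (a w) m0.
  have [nb|] := H r I.
    apply: nb; apply: ball_sym; apply: le_ball rb.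
    by rewrite ge_min lexx orbT.
  apply; exists (g (a w, Phi w)) => //.
  by apply: dg; apply: le_ball rb; rewrite ge_min lexx.
Qed.

Lemma measurable_mixed :
  measurable_fun setT ((fun w => g (a w, Phi w)) : Omega R -> borelV R n).
Proof.
apply: (@measurability _ _ (Omega R) (borelV R n) setT _ (@open 'rV[R]_n) erefl).
move=> _ [U oU <-]; rewrite setTI.
rewrite -[X in measurable X]/[set w | U (g (a w, Phi w))] cellE//.
apply: bigcupT_measurable => j; apply: bigcupT_measurable => k.
pose C (r : 'rV[rat]_m) := ~` [set w | ball (q r) k.+1%:R^-1 (a w : 'rV[R]_m)] `|`
  [set w | inner U j (g (q r, Phi w))].
have -> : \bigcap_(r in [set: 'rV[rat]_m]) C r =
    \bigcap_(i : nat) (if unpickle i is Some r then C r else setT).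
  apply/seteqP; split=> w H.
    by move=> i _; case: (unpickle i) => // r; exact: H.
  by move=> r _; have := H (pickle r) I; rewrite pickleK.
apply: bigcapT_measurable => i; case: (unpickle i) => [r|//].
apply: measurableU.
  apply: measurableC; rewrite -[X in measurable X]setTI.
  by apply: (am measurableT); apply: sub_sigma_algebra; exact: ball_open.
apply: (@measurable_inner U j (fun w => g (q r, Phi w))).
by apply: (@measurableT_comp _ _ _ _ _ _ (fun w => g (q r, w) : borelV R n)).
Qed.

End caratheodory.

Lemma smooth_R0 (R : realType) (n : nat) (f : 'rV[R]_0 -> 'rV[R]_n) : smooth f.
Proof.
have fc : continuous f.
  have -> : f = cst (f 0) by apply/funext => x; rewrite [x]thinmx0.
  by move=> x; exact: cst_continuous.
by case=> [|k] //=; split => // -[].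
Qed.

Lemma smooth_continuous (R : realType) (m n : nat) (f : 'rV[R]_m -> 'rV[R]_n) :
  smooth f -> continuous f.
Proof. by move/(_ 0%N). Qed.

Lemma site_hom_comp0 (R : realType) (m n : nat) (h : Omega_ R m -> Omega_ R n)
    (h' : Omega_ R 0 -> Omega_ R m) :
  site_hom R m n h -> site_hom R 0 m h' -> site_hom R 0 n (h \o h').
Proof.
move=> [g [Phi [[gs gm] Phim ->]]] [g' [Phi' [[_ g'm] Phi'm ->]]].
exists (fun tw => g (g' tw, Phi' tw.2)), (Phi \o Phi'); split => //.
- split=> [w|t]; first exact: smooth_R0.
  apply: (@measurable_mixed R m n g _ gm (fun w => g' (t, w)) Phi') => //.
  by move=> w; exact: smooth_continuous.
- exact: measurableT_comp.
Qed.

Lemma site_hom_base (R : realType) (Phi : Omega R -> Omega R) :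
  measurable_fun setT Phi -> site_hom R 0 0 (site_map (cst 0) Phi).
Proof.
move=> Phim; exists (cst 0), Phi; split => //.
by split=> [w|t]; [exact: smooth_R0 | exact: measurable_cst].
Qed.

Record qus (R : realType) := QUS {
  qus_sort :> Type;
  rv : set (Omega R -> qus_sort);
  rv_cst : forall s : qus_sort, rv (cst s);
  rv_comp : forall (X : Omega R -> qus_sort) (Phi : Omega R -> Omega R),
    rv X -> measurable_fun setT Phi -> rv (X \o Phi)
}.
Arguments rv {R} _.
Arguments rv_cst {R} _.

Record qus_hom (R : realType) (S T : qus R) := QUSHom {
  qus_fun :> S -> T;
  qus_homP : forall X, rv S X -> rv T (qus_fun \o X)
}.

Lemma qus_hom_eq (R : realType) (S T : qus R) (f g : qus_hom S T) :
  qus_fun f =1 qus_fun g -> f = g.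
Proof.
case: f g => [f fP] [g gP] /= /funext fg.
by rewrite -fg in gP *; congr QUSHom; exact: Prop_irrelevance.
Qed.

Definition qus_id (R : realType) (S : qus R) : qus_hom S S :=
  @QUSHom R S S id (fun X rX => rX).

Definition qus_comp (R : realType) (S T U : qus R)
    (g : qus_hom T U) (f : qus_hom S T) : qus_hom S U :=
  @QUSHom R S U (g \o f) (fun X rX => qus_homP g (qus_homP f rX)).

Definition QUSCat (R : realType) : category.
Proof.
refine (@Category (qus R) (@qus_hom R) (@qus_id R) (@qus_comp R) _ _ _).
- by move=> S T f; exact: qus_hom_eq.
- by move=> S T f; exact: qus_hom_eq.
- by move=> S T U V h g f; exact: qus_hom_eq.
Defined.

Definition qus_prod (R : realType) (I : Type) (S : I -> qus R) : qus R.
Proof.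
refine (@QUS R (forall i, S i) [set X | forall i, rv (S i) (fun w => X w i)] _ _).
- by move=> s i; exact: rv_cst.
- by move=> X Phi rX Phim i; exact: (rv_comp (rX i) Phim).
Defined.

Definition qus_proj (R : realType) (I : Type) (S : I -> qus R) (i : I) :
    qus_hom (qus_prod S) (S i) :=
  @QUSHom R (qus_prod S) (S i) (fun s => s i) (fun X rX => rX i).

Lemma qus_prodP (R : realType) (I : Type) (S : I -> qus R) :
  @is_product (QUSCat R) I S (qus_prod S) (qus_proj S).
Proof.
move=> Q f; unshelve eexists (@QUSHom R Q (qus_prod S) (fun x i => f i x) _).
  by move=> X rX i; exact: (qus_homP (f i) rX).
split=> [i|h hP]; first exact: qus_hom_eq.
apply: qus_hom_eq => x; apply/functional_extensionality_dep => i /=.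
by rewrite -hP.
Qed.

Definition qus_Omega (R : realType) : qus R.
Proof.
refine (@QUS R (Omega R) [set Phi | measurable_fun setT Phi] _ _).
- by move=> w; exact: measurable_cst.
- by move=> X Phi; exact: measurableT_comp.
Defined.

Record sss (R : realType) := SSS {
  sss_sort :> Type;
  plot : forall n, set (Omega_ R n -> sss_sort);
  plot_cst : forall n (x : sss_sort), @plot n (cst x);
  plot_comp : forall m n (p : Omega_ R n -> sss_sort) (h : Omega_ R m -> Omega_ R n),
    @plot n p -> site_hom R m n h -> @plot m (p \o h)
}.
Arguments plot {R} _ _.
Arguments plot_cst {R} _.

Record sss_hom (R : realType) (X Y : sss R) := SSSHom {
  sss_fun :> X -> Y;
  sss_homP : forall n p, plot X n p -> plot Y n (sss_fun \o p)
}.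

Lemma sss_hom_eq (R : realType) (X Y : sss R) (f g : sss_hom X Y) :
  sss_fun f =1 sss_fun g -> f = g.
Proof.
case: f g => [f fP] [g gP] /= /funext fg.
by rewrite -fg in gP *; congr SSSHom; exact: Prop_irrelevance.
Qed.

Definition sss_id (R : realType) (X : sss R) : sss_hom X X :=
  @SSSHom R X X id (fun n p pp => pp).

Definition sss_comp (R : realType) (X Y Z : sss R)
    (g : sss_hom Y Z) (f : sss_hom X Y) : sss_hom X Z :=
  @SSSHom R X Z (g \o f) (fun n p pp => sss_homP g (sss_homP f pp)).

Definition SSSCat (R : realType) : category.
Proof.
refine (@Category (sss R) (@sss_hom R) (@sss_id R) (@sss_comp R) _ _ _).
- by move=> S T f; exact: sss_hom_eq.
- by move=> S T f; exact: sss_hom_eq.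
- by move=> S T U V h g f; exact: sss_hom_eq.
Defined.

Definition sss_prod (R : realType) (I : Type) (X : I -> sss R) : sss R.
Proof.
refine (@SSS R (forall i, X i)
  (fun n => [set p | forall i, plot (X i) n (fun tw => p tw i)]) _ _).
- by move=> n x i; exact: plot_cst.
- by move=> m n p h pp hh i; exact: (plot_comp (pp i) hh).
Defined.

Definition sss_proj (R : realType) (I : Type) (X : I -> sss R) (i : I) :
    sss_hom (sss_prod X) (X i) :=
  @SSSHom R (sss_prod X) (X i) (fun x => x i) (fun n p pp => pp i).

Lemma sss_prodP (R : realType) (I : Type) (X : I -> sss R) :
  @is_product (SSSCat R) I X (sss_prod X) (sss_proj X).
Proof.
move=> Q f; unshelve eexists (@SSSHom R Q (sss_prod X) (fun x i => f i x) _).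
  by move=> n p pp i; exact: (sss_homP (f i) pp).
split=> [i|h hP]; first exact: sss_hom_eq.
apply: sss_hom_eq => x; apply/functional_extensionality_dep => i /=.
by rewrite -hP.
Qed.

Definition nat_obj (R : realType) (X : sss R) : qus R.
Proof.
refine (@QUS R X [set Y : Omega R -> X | plot X 0 (Y \o site_pi R 0)] _ _).
- by move=> x; exact: plot_cst.
- by move=> Y Phi pY Phim; exact: (plot_comp pY (site_hom_base Phim)).
Defined.

Definition nat_map (R : realType) (X Y : sss R) (f : sss_hom X Y) :
    qus_hom (nat_obj X) (nat_obj Y) :=
  @QUSHom R (nat_obj X) (nat_obj Y) f (fun Z pZ => sss_homP f pZ).

Definition natF (R : realType) : functor (SSSCat R) (QUSCat R).
Proof.
refine (@Functor (SSSCat R) (QUSCat R) (@nat_obj R) (@nat_map R) _ _).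
- by move=> X; exact: qus_hom_eq.
- by move=> X Y Z g f; exact: qus_hom_eq.
Defined.

Definition flat_obj (R : realType) (S : qus R) : sss R.
Proof.
refine (@SSS R S (fun n => [set X \o site_pi R n | X in rv S]) _ _).
- by move=> n s; exists (cst s) => //; exact: rv_cst.
- move=> m n _ _ [X rX <-] [g [Phi [_ Phim ->]]].
  by exists (X \o Phi) => //; exact: rv_comp.
Defined.

Definition flat_map (R : realType) (S T : qus R) (f : qus_hom S T) :
  sss_hom (flat_obj S) (flat_obj T).
Proof.
refine (@SSSHom R (flat_obj S) (flat_obj T) f _).
by move=> n _ [X rX <-]; exists (f \o X) => //; exact: qus_homP.
Defined.

Definition flatF (R : realType) : functor (QUSCat R) (SSSCat R).
Proof.
refine (@Functor (QUSCat R) (SSSCat R) (@flat_obj R) (@flat_map R) _ _).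
- by move=> X; exact: sss_hom_eq.
- by move=> X Y Z g f; exact: sss_hom_eq.
Defined.

Definition sharp_obj (R : realType) (S : qus R) : sss R.
Proof.
refine (@SSS R S (fun n => [set p : Omega_ R n -> S | forall h, site_hom R 0 n h ->
  rv S (p \o h \o @site_pt R)]) _ _).
- by move=> n s h _; exact: rv_cst.
- by move=> m n p h pp hh h' hh'; exact: (pp _ (site_hom_comp0 hh hh')).
Defined.

Definition sharp_map (R : realType) (S T : qus R) (f : qus_hom S T) :
  sss_hom (sharp_obj S) (sharp_obj T).
Proof.
refine (@SSSHom R (sharp_obj S) (sharp_obj T) f _).
by move=> n p pp h hh; exact: (qus_homP f (pp h hh)).
Defined.

Definition sharpF (R : realType) : functor (QUSCat R) (SSSCat R).
Proof.
refine (@Functor (QUSCat R) (SSSCat R) (@sharp_obj R) (@sharp_map R) _ _).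
- by move=> X; exact: sss_hom_eq.
- by move=> X Y Z g f; exact: sss_hom_eq.
Defined.

Definition Lambda_obj (R : realType) (X : sss R) : qus R.
Proof.
refine (@QUS R X
  [set Y : Omega R -> X | exists f : sss_hom (sharp_obj (qus_Omega R)) X, Y = sss_fun f] _ _).
- move=> x.
  unshelve eexists (@SSSHom R (sharp_obj (qus_Omega R)) X (cst x) _) => //.
  by move=> n p _; exact: plot_cst.
- move=> _ Phi [f ->] Phim.
  pose Phi' := @QUSHom R (qus_Omega R) (qus_Omega R) Phi
    (fun Y Ym => measurableT_comp Phim Ym).
  by exists (sss_comp f (sharp_map Phi')).
Defined.

Definition Lambda_map (R : realType) (X Y : sss R) (f : sss_hom X Y) :
  qus_hom (Lambda_obj X) (Lambda_obj Y).
Proof.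
refine (@QUSHom R (Lambda_obj X) (Lambda_obj Y) f _).
by move=> _ [g ->]; exists (sss_comp f g).
Defined.

Definition LambdaF (R : realType) : functor (SSSCat R) (QUSCat R).
Proof.
refine (@Functor (SSSCat R) (QUSCat R) (@Lambda_obj R) (@Lambda_map R) _ _).
- by move=> X; exact: qus_hom_eq.
- by move=> X Y Z g f; exact: qus_hom_eq.
Defined.

Definition piece_step (R : realType) (X : sss R) (x y : X) : Prop :=
  exists p (t t' : 'rV[R]_1) (w : Omega R),
    [/\ plot X 1 p, x = p (t, w) & y = p (t', w)].

Definition piece_equiv (R : realType) (X : sss R) : X -> X -> Prop :=
  clos_refl_sym_trans X (@piece_step R X).

(* the quotient X/~ as its set of equivalence classes *)
Definition pieces (R : realType) (X : sss R) :=
  {c : set X | exists x, c = piece_equiv x}.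

Definition piece_proj (R : realType) (X : sss R) (x : X) : pieces X :=
  exist _ (piece_equiv x) (ex_intro _ x erefl).

Lemma piece_projP (R : realType) (X : sss R) (x y : X) :
  piece_proj x = piece_proj y <-> piece_equiv x y.
Proof.
split=> [/(congr1 sval) /= ->|xy]; first exact: rst_refl.
apply: eq_exist => /=; apply/seteqP; split=> z.
- by apply: rst_trans; exact: rst_sym.
- exact: rst_trans.
Qed.

Lemma piece_proj_surj (R : realType) (X : sss R) (c : pieces X) :
  exists x, piece_proj x = c.
Proof. by case: c => c [x cx]; exists x; exact: eq_exist. Qed.

Definition piece_repr (R : realType) (X : sss R) (c : pieces X) : X :=
  projT1 (cid (piece_proj_surj c)).

Lemma piece_reprK (R : realType) (X : sss R) (c : pieces X) :
  piece_proj (piece_repr c) = c.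
Proof. exact: projT2 (cid (piece_proj_surj c)). Qed.

(* For empty X this is still the final structure, since there is then no map
   from Omega to the quotient. *)
Definition Pi_obj (R : realType) (X : sss R) : qus R.
Proof.
refine (@QUS R (pieces X) [set @piece_proj R X \o Y | Y in rv (nat_obj X)] _ _).
- move=> c; exists (cst (piece_repr c)); first exact: rv_cst.
  by apply/funext => w /=; rewrite piece_reprK.
- by move=> _ Phi [Y rY <-] Phim; exists (Y \o Phi) => //; exact: rv_comp.
Defined.

Definition piece_map (R : realType) (X Y : sss R) (f : X -> Y) :
  pieces X -> pieces Y := fun c => piece_proj (f (piece_repr c)).

Lemma piece_mapE (R : realType) (X Y : sss R) (f : sss_hom X Y) (x : X) :
  piece_map f (piece_proj x) = piece_proj (f x).
Proof.
apply/piece_projP; have /piece_projP := piece_reprK (piece_proj x).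
move: (piece_repr _) => x'; elim=> {x x'} [_ _ [p [t [t' [w [pp -> ->]]]]]|y|y z _|y z u _ yz _ zu].
- by apply: rst_step; exists (f \o p), t, t', w; split => //; exact: sss_homP.
- exact: rst_refl.
- exact: rst_sym.
- exact: rst_trans yz zu.
Qed.

Definition Pi_map (R : realType) (X Y : sss R) (f : sss_hom X Y) :
  qus_hom (Pi_obj X) (Pi_obj Y).
Proof.
refine (@QUSHom R (Pi_obj X) (Pi_obj Y) (piece_map f) _).
move=> _ [Z rZ <-]; exists (f \o Z); first exact: (qus_homP (nat_map f) rZ).
by apply/funext => w /=; rewrite piece_mapE.
Defined.

Definition PiF (R : realType) : functor (SSSCat R) (QUSCat R).
Proof.
refine (@Functor (SSSCat R) (QUSCat R) (@Pi_obj R) (@Pi_map R) _ _).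
- move=> X; apply: qus_hom_eq => c /=.
  by have [x <-] := piece_proj_surj c; exact: (piece_mapE (sss_id X)).
- move=> X Y Z g f; apply: qus_hom_eq => c /=.
  have [x <-] := piece_proj_surj c.
  by rewrite !piece_mapE; exact: (piece_mapE (sss_comp g f)).
Defined.

(* Main.v *)
From HB Require Import structures.
From Stdlib Require Import Relations.
Require Import Defs.
From mathcomp Require Import all_boot all_order all_algebra.
From mathcomp Require Import all_classical all_reals all_analysis.
From mathcomp Require Import measurable_realfun.

Set Implicit Arguments.
Unset Strict Implicit.
Unset Printing Implicit Defensive.
Import Order.TTheory GRing.Theory Num.Theory.
Import numFieldNormedType.Exports.

Local Open Scope classical_set_scope.
Local Open Scope ring_scope.

(** Every functor of the string except [PiF] acts as the identity on
underlying maps, so each adjunction says that the same maps of sets are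
morphisms on both sides; only the transfer of plots and of random variables
has to be proved.

- [Pi -| flat]: any two points of the fibre of a plot over the same [w] are
  joined by an affine line in R^n, and precomposing with that line gives a
  plot on R^1 ([plot_piece]). So [piece_proj \o p] depends only on [w] for
  every plot [p], as a random variable, and is a plot of the discrete space.
- [flat -| nat] and [nat -| sharp]: pull an Omega_0-plot back along the
  projection from Omega_n, resp. pull an Omega_n-plot back along all the site
  maps from Omega_0; an Omega_0-plot is a random variable because R^0 is a
  point.
- [sharp -| Lambda]: this is the step with analytic content. Let
  [g : S -> Lambda X] and let [p] be a plot of [sharp S] on Omega_n; one has
  to see that [g \o p] is a plot of X, while [g] is controlled only on
  random variables. The object Omega_n is a measurable retract of Omega: R^n
  is squeezed into the first n coordinates and the old sequence is shifted
  ([Omega_code], [Omega_decode]). The random variable [p \o Omega_decode]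
  is sent by [g] to a sample-smooth map [f] on [sharp Omega], and
  [g \o p = f \o Omega_code], where [Omega_code] is a plot of [sharp Omega].

That coding and decoding are measurable for the universally measurable sets
rests on two facts: a self-map of Omega with universally measurable
coordinates pulls universally measurable sets back to such sets
([measurable_fun_Omega]), and a vector-valued map with measurable
coordinates is Borel measurable ([measurable_row]).

The functor Pi preserves finite products because the pieces of a finite
product are the products of pieces: constants are plots, so one coordinate
at a time may be moved along a chain of plots, and finitely many moves
suffice ([piece_equiv_prod]). *)

(** * Universally measurable self-maps of the sample space *)

Section completion_pushforward.
Variables (R : realType) (P : probability (borelOmega R) R).
Variable Phi : Omega R -> Omega R.
Hypothesis Phim : forall (k : nat) (B : set R), measurable B ->
  universally_measurable [set w | B (sval (Phi w) k)].

Let outer : {outer_measure set (borelOmega R) -> \bar R} := (P^*)%mu.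
Local Notation cara := (caratheodory_type outer).

(** The Caratheodory extension of [P] is defined on all universally measurable
sets; this gives a measure to push forward along a map that is only
universally measurable. *)
Lemma universally_measurable_cara A :
  universally_measurable A -> outer.-cara.-measurable A.
Proof.
move=> /(_ P)[B mB [N [M [mM M0 NM]] <-]].
have carab C : measurable (C : set (borelOmega R)) -> outer.-cara.-measurable C.
  by move=> mC; apply: sub_caratheodory; exact: sub_sigma_algebra.
apply: measurableU; first exact: carab.
apply: measure_is_complete_caratheodory; exists M; split => //.
- exact: carab.
- by rewrite /= /outer measurable_mu_extE.
Qed.

Lemma measurable_cara : measurable_fun setT (Phi : cara -> borelOmega R).
Proof.
apply: (@measurability _ _ cara (borelOmega R) setT _ (@omega_cylinder R) erefl).
move=> _ [_ [k [B [mB ->]]] <-]; rewrite setTI.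
exact: universally_measurable_cara (Phim k mB).
Qed.

(** The law of [Phi] under the completion of [P], restricted to Borel sets. *)
Let Q : set (borelOmega R) -> \bar R :=
  pushforward (outer : set cara -> \bar R) (Phi : cara -> borelOmega R).

Let Qset0 : Q set0 = 0%E.
Proof. by rewrite /Q /pushforward preimage_set0 outer_measure0. Qed.

Let Q_ge0 A : (0 <= Q A)%E.
Proof. exact: outer_measure_ge0. Qed.

Let Q_sigma_additive : semi_sigma_additive Q.
Proof.
by apply: measure_semi_sigma_additive; exact: measurable_cara.
Qed.

HB.instance Definition _ := isMeasure.Build _ _ _ Q Qset0 Q_ge0 Q_sigma_additive.

Let Q_setT : Q setT = 1%E.
Proof.
by rewrite -[RHS](probability_setT P) -(measurable_mu_extE P).
Qed.

HB.instance Definition _ := Measure_isProbability.Build _ _ _ Q Q_setT.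

(** [A] is the union of a Borel set and of a part of a [Q]-null Borel set [M],
and [Phi @^-1` M] is universally measurable of outer [P]-measure 0, hence
[P]-negligible. So [Phi @^-1` A] differs by a [P]-negligible set from the
preimage of a Borel set, which is [P]-completed measurable. *)
Lemma preimage_completed A :
  universally_measurable A -> completed_algebra_gen P (Phi @^-1` A).
Proof.
have mPhi (C : set (borelOmega R)) : measurable C ->
    universally_measurable (Phi @^-1` C).
  have : measurable_fun setT (Phi : Omega R -> borelOmega R).
    apply: (@measurability _ _ (Omega R) (borelOmega R) setT _
      (@omega_cylinder R) erefl).
    by move=> _ [_ [k [B [mB ->]]] <-]; rewrite setTI; exact: Phim.
  by move=> /(_ measurableT C) + mC => /(_ mC); rewrite setTI.
move=> /(_ Q)[B mB [N [M [mM M0 NM]] <-]].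
have [B1 mB1 [N1 nN1 EB]] := mPhi _ mB P.
have [B2 mB2 [N2 nN2 EM]] := mPhi _ mM P.
exists B1 => //; exists (N1 `|` Phi @^-1` N); last first.
  by rewrite setUA EB -preimage_setU.
apply: negligibleU => //; apply: negligibleS (preimage_subset NM) _.
rewrite -EM; apply: negligibleU => //; apply/negligibleP => //.
apply: (etrans (esym (measurable_mu_extE P mB2))).
apply/eqP; rewrite eq_le outer_measure_ge0 andbT -M0.
by apply: le_outer_measure; rewrite -EM; exact: subsetUl.
Qed.

End completion_pushforward.

(** Coordinates generate only the Borel sets of the target; the universally
measurable sets that are not Borel are reached through [preimage_completed]. *)
Lemma measurable_fun_Omega (R : realType) (Phi : Omega R -> Omega R) :
  (forall k, measurable_fun setT (fun w => sval (Phi w) k)) ->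
  measurable_fun setT Phi.
Proof.
move=> Phim _ A mA; rewrite setTI.
change (universally_measurable (Phi @^-1` A)) => P.
apply: preimage_completed => // k B mB.
by have := Phim k measurableT B mB; rewrite setTI.
Qed.

Lemma measurable_coord (R : realType) (k : nat) :
  measurable_fun setT (fun w : Omega R => sval w k).
Proof.
move=> _ B mB; rewrite setTI.
change (universally_measurable [set w : Omega R | B (sval w k)]) => P.
exists [set w | B (sval w k)].
  by apply: sub_sigma_algebra; exists k, B.
by exists set0; [exact: negligible_set0|rewrite setU0].
Qed.

(** * Smooth lines and measurable vectors *)

Lemma smooth_cst (R : realType) (m n : nat) (c : 'rV[R]_n) :
  smooth (cst c : 'rV[R]_m -> 'rV[R]_n).
Proof.
move=> k; elim: k c => [|k IHk] c /=; first exact: cst_continuous.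
split=> [|i]; first exact: cst_continuous.
split=> [x|]; first exact: derivable_cst.
by rewrite (_ : (fun x => _) = cst 0) //; apply/funext => x; exact: derive_cst.
Qed.

(** The first derivatives are constant, so [smooth_cst] ends the recursion on
the order. *)
Lemma smooth_line (R : realType) (n : nat) (a v : 'rV[R]_n) :
  smooth (fun t : 'rV[R]_1 => a + t 0 0 *: v).
Proof.
have fc : continuous (fun t : 'rV[R]_1 => a + t 0 0 *: v).
  move=> t.
  apply: (@continuousD _ _ _ (cst a) (fun t : 'rV[R]_1 => t 0 0 *: v)).
    exact: cst_continuous.
  by apply: continuousZr_tmp; exact: coord_continuous.
have fd (t u : 'rV[R]_1) :
    is_derive t u (fun t : 'rV[R]_1 => a + t 0 0 *: v) (u 0 0 *: v).
  have lim_quot : h^-1 *: ((a + (h *: u + t) 0 0 *: v) - (a + t 0 0 *: v))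
      @[h --> (0 : R)^'] --> u 0 0 *: v.
    apply: cvg_near_cst; near=> h.
    have h0 : h != 0 by near: h; exact: nbhs_dnbhs_neq.
    rewrite opprD addrACA subrr add0r -scalerBl !mxE addrK scalerA mulrA.
    by rewrite mulVf// mul1r.
  by apply: DeriveDef; [apply/cvg_ex; exists (u 0 0 *: v)|exact/cvg_lim].
case=> [|k] //=; split=> // i; split=> [t|]; first exact: ex_derive.
have -> : (fun t => 'D_(delta_mx 0 i) (fun t : 'rV[R]_1 => a + t 0 0 *: v) t) =
    cst (delta_mx (0 : 'I_1) i 0 0 *: v).
  by apply/funext => t; exact: derive_val.
exact: smooth_cst.
Unshelve. all: by end_near. Qed.

(** The components are added one at a time: the map
[(t, w) |-> c + t *: 'e_i + (sum over the other components)] is continuous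
in [t] and, by induction, measurable in [w], so that [measurable_mixed]
allows the measurable component [a i w] to be substituted for [t]. *)
Lemma measurable_row (R : realType) (n : nat) (a : 'I_n -> Omega R -> R) :
  (forall i, measurable_fun setT (a i)) ->
  measurable_fun setT ((fun w => \row_i a i w) : Omega R -> borelV R n).
Proof.
move=> am.
(* The free constant [c] absorbs the fixed part of the sum in the induction. *)
have partm (s : seq 'I_n) (c : 'rV[R]_n) : measurable_fun setT
   ((fun w => c + \sum_(i <- s) a i w *: delta_mx 0 i) : Omega R -> borelV R n).
  elim: s c => [|i s IHs] c.
    under eq_fun do rewrite big_nil.
    exact: measurable_cst.
  pose g (tw : Omega_ R 1) : 'rV[R]_n := c + tw.1 0 0 *: delta_mx 0 i +
     \sum_(j <- s) a j tw.2 *: delta_mx 0 j.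
  rewrite (_ : (fun w => _) = (fun w => g (\row__ a i w, w))); last first.
    by apply/funext => w; rewrite /g big_cons addrA mxE.
  apply: (@measurable_mixed R 1 n g _ _ (fun w => \row__ a i w) id) => //.
  - move=> w t.
    apply: (@continuousD _ _ _ (fun t : 'rV[R]_1 => c + t 0 0 *: delta_mx 0 i)
      (cst (\sum_(j <- s) a j w *: delta_mx 0 j))).
      exact: (smooth_continuous (smooth_line c (delta_mx 0 i))).
    exact: cst_continuous.
  - by move=> t; exact: (IHs (c + t 0 0 *: delta_mx 0 i)).
  - apply: (@measurability _ _ (Omega R) (borelV R 1) setT _ (@open 'rV[R]_1) erefl).
    move=> _ [U oU <-]; apply: (am i measurableT [set x | U (\row__ x)]).
    apply: open_measurable; apply: open_comp oU => x _.
    rewrite (_ : (fun t => \row__ t) = *:%R^~ (const_mx 1)).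
      exact: scalel_continuous.
    by apply/funext => t; apply/rowP => j; rewrite !mxE mulr1.
rewrite (_ : (fun w => _) = (fun w => 0 + \sum_(i <- enum 'I_n) a i w *: delta_mx 0 i)).
  exact: partm.
apply/funext => w; rewrite add0r [LHS]row_sum_delta big_enum /=.
by apply: eq_bigr => i _; rewrite mxE.
Qed.

Lemma measurable_borelV_coord (R : realType) (n : nat) (a : Omega R -> borelV R n) i :
  measurable_fun setT a -> measurable_fun setT (fun w => (a w : 'rV[R]_n) 0 i).
Proof.
move=> am.
apply: (measurability _ (RGenOpens.measurableE R)).
move=> _ [_ [x [y ->]] <-].
apply: (am measurableT [set v : 'rV[R]_n | `]x, y[%classic (v 0 i)]).
apply: sub_sigma_algebra; apply: open_comp; last exact: interval_open.
by move=> v _; exact: coord_continuous.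
Qed.

(** * The stage R^n x Omega as a retract of Omega *)

Section coding.
Variables (R : realType) (n : nat).

Lemma squash_itv01 (x : R) : 0 <= expR (- expR x) <= 1.
Proof. by rewrite expR_ge0 -expR0 ler_expR oppr_le0 expR_ge0. Qed.

(** Any Borel injection of R into [0, 1] with a Borel left inverse would do;
exp(-exp x) is undone by ln(-ln v), a composite of measurable functions, with
no case distinction at the end points. *)
Definition squash (x : R) : R := expR (- expR x).
Definition unsquash (v : R) : R := ln (- ln v).

Lemma squashK : cancel squash unsquash.
Proof. by move=> x; rewrite /unsquash /squash expRK opprK expRK. Qed.

Lemma measurable_squash : measurable_fun setT squash.
Proof.
by apply: measurableT_comp => //; apply: measurableT_comp => //; exact: measurable_expR.
Qed.

Lemma measurable_unsquash : measurable_fun setT unsquash.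
Proof.
apply: measurableT_comp; first exact: measurable_ln.
by apply: measurableT_comp => //; exact: measurable_ln.
Qed.

(** [insub k] fails exactly for [n <= k], so [k - n] is never truncated. *)
Definition Omega_code_coord (tw : Omega_ R n) (k : nat) : R :=
  if insub k is Some i then squash (tw.1 0 (i : 'I_n)) else sval tw.2 (k - n)%N.

Lemma Omega_code_itv01 tw k : 0 <= Omega_code_coord tw k <= 1.
Proof.
rewrite /Omega_code_coord; case: insubP => [i _ _|_]; first exact: squash_itv01.
exact: (svalP tw.2).
Qed.

Definition Omega_code (tw : Omega_ R n) : Omega R := exist _ _ (Omega_code_itv01 tw).

Definition Omega_drop (w : Omega R) : Omega R :=
  exist (fun v => forall k, 0 <= v k <= 1) (fun k => sval w (n + k)%N)
    (fun k => svalP w (n + k)%N).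

Definition Omega_decode (w : Omega R) : Omega_ R n :=
  (\row_i unsquash (sval w i), Omega_drop w).

Lemma Omega_codeK : cancel Omega_code Omega_decode.
Proof.
move=> [t [w wP]]; congr pair.
  by apply/rowP => i; rewrite mxE /= /Omega_code_coord valK squashK.
apply: eq_exist; apply/funext => k /=.
by rewrite /Omega_code_coord insubN -?leqNgt ?leq_addr// addKn.
Qed.

Lemma Omega_decode_site : site_hom R 0 n (Omega_decode \o site_pi R 0).
Proof.
exists (fun tw => (Omega_decode tw.2).1), Omega_drop; split => //.
- split=> [w|t]; first exact: smooth_R0.
  apply: measurable_row => i; apply: measurableT_comp; last exact: measurable_coord.
  exact: measurable_unsquash.
- by apply: measurable_fun_Omega => k; exact: measurable_coord.
Qed.

Lemma Omega_code_plot : plot (sharp_obj (qus_Omega R)) n Omega_code.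
Proof.
move=> _ [g [Phi [[_ gm] Phim ->]]] /=.
apply: measurable_fun_Omega => k /=; rewrite /Omega_code_coord /=.
case: insubP => [i _ _|_].
  apply: measurableT_comp; first exact: measurable_squash.
  exact: (measurable_borelV_coord i (gm 0)).
exact: measurableT_comp (measurable_coord _) Phim.
Qed.

End coding.

(** * Morphisms of the site *)

(** With [m = 0] these are the slices of Omega_n, with [n = 0] the projection
to Omega. *)
Lemma site_hom_fix (R : realType) (m n : nat) (c : 'rV[R]_n) :
  site_hom R m n (site_map (cst c) id).
Proof.
exists (cst c), id; split=> //; first split=> [w|t].
- exact: smooth_cst.
- exact: measurable_cst.
Qed.

Lemma site_hom_line (R : realType) (n : nat) (a v : 'rV[R]_n) :
  site_hom R 1 n (site_map (fun tw : Omega_ R 1 => a + tw.1 0 0 *: v) id).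
Proof.
exists (fun tw : Omega_ R 1 => a + tw.1 0 0 *: v), id; split=> //; split=> [w|t].
- exact: smooth_line.
- exact: (measurable_cst (a + t 0 0 *: v : borelV R n)).
Qed.

Lemma site_hom_id0 (R : realType) : site_hom R 0 0 id.
Proof.
rewrite (_ : id = site_map (cst 0) id); first exact: site_hom_fix.
by apply/funext => -[t w]; rewrite [t]thinmx0.
Qed.

Lemma site_piK (R : realType) : cancel (site_pi R 0) (@site_pt R).
Proof. by move=> [t w]; rewrite /site_pt [t]thinmx0. Qed.

(** * Plots and random variables *)

Section plots.
Variables (R : realType) (X : sss R).

Lemma plot_pi n (Y : Omega R -> X) :
  rv (nat_obj X) Y -> plot X n (Y \o site_pi R n).
Proof. by move=> rY; exact: (plot_comp rY (site_hom_fix n 0)). Qed.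

Lemma plot_rv0 (p : Omega_ R 0 -> X) :
  plot X 0 p -> rv (nat_obj X) (p \o @site_pt R).
Proof.
rewrite /= (_ : _ \o site_pi R 0 = p) //.
by apply/funext => tw /=; rewrite site_piK.
Qed.

Lemma plot_fiber n (p : Omega_ R n -> X) (t : 'rV[R]_n) :
  plot X n p -> rv (nat_obj X) (fun w => p (t, w)).
Proof. by move=> pp; exact: (plot_rv0 (plot_comp pp (site_hom_fix 0 t))). Qed.

(** Restrict [p] to the line through [t] and [t'] over the sample [w]. *)
Lemma plot_piece n (p : Omega_ R n -> X) (t t' : 'rV[R]_n) (w : Omega R) :
  plot X n p -> piece_proj (p (t, w)) = piece_proj (p (t', w)).
Proof.
move=> pp; apply/piece_projP; apply: rst_step.
exists (p \o site_map (fun tw : Omega_ R 1 => t + tw.1 0 0 *: (t' - t)) id),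
  0, (const_mx 1), w.
split; first exact: plot_comp pp (site_hom_line _ _).
- by rewrite /= /site_map /= mxE scale0r addr0.
- by rewrite /= /site_map /= mxE scale1r addrC subrK.
Qed.

End plots.

Lemma flat_rv (R : realType) (S : qus R) (n : nat) (Y : Omega R -> S) :
  plot (flat_obj S) n (Y \o site_pi R n) <-> rv S Y.
Proof.
split=> [[Z rZ ZY]|rY]; last by exists Y.
suff <- : Z = Y by [].
by apply/funext => w; exact: (congr1 (fun f => f (0, w)) ZY).
Qed.

Lemma sharp_rv (R : realType) (S : qus R) (Y : Omega R -> S) :
  plot (sharp_obj S) 0 (Y \o site_pi R 0) <-> rv S Y.
Proof.
split=> [pY|rY _ [g [Phi [_ Phim ->]]]].
  exact: (pY _ (site_hom_id0 R)).
exact: rv_comp rY Phim.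
Qed.

(** * The adjunction between pieces and discrete spaces *)

Section Pi_flat.
Variables (R : realType) (X : sss R) (S : qus R).

Lemma flat_of_Pi_plot (f : qus_hom (Pi_obj X) S) n p :
  plot X n p -> plot (flat_obj S) n (f \o @piece_proj R X \o p).
Proof.
move=> pp; exists (f \o @piece_proj R X \o (fun w => p (0, w))).
  by apply: (qus_homP f); exists (fun w => p (0, w)) => //; exact: plot_fiber.
by apply/funext => -[t w] /=; rewrite (plot_piece 0 t w pp).
Qed.

Definition flat_of_Pi (f : qus_hom (Pi_obj X) S) : sss_hom X (flat_obj S) :=
  SSSHom (flat_of_Pi_plot f).

(** A plot of [flat S] on R^1 factors through the sample, so a map into [flat S]
is constant along the steps generating the equivalence. *)
Lemma flat_hom_piece (g : sss_hom X (flat_obj S)) (x : X) :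
  g (piece_repr (piece_proj x)) = g x.
Proof.
have /piece_projP := piece_reprK (piece_proj x); move: (piece_repr _) => x'.
elim=> {x x'} [_ _ [p [t [t' [w [pp -> ->]]]]]|//|x y _ ->//|x y z _ -> _ ->//].
have [Y _ gp] := sss_homP g pp.
by rewrite -[LHS]/((g \o p) (t, w)) -[RHS]/((g \o p) (t', w)) -gp.
Qed.

Lemma Pi_of_flat_rv (g : sss_hom X (flat_obj S)) Y :
  rv (Pi_obj X) Y -> rv S (g \o @piece_repr R X \o Y).
Proof.
move=> [Z rZ <-]; apply/(flat_rv 0).
rewrite (_ : _ \o site_pi R 0 = g \o (Z \o site_pi R 0)); first exact: sss_homP.
by apply/funext => tw /=; rewrite flat_hom_piece.
Qed.

Definition Pi_of_flat (g : sss_hom X (flat_obj S)) : qus_hom (Pi_obj X) S :=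
  QUSHom (Pi_of_flat_rv g).

End Pi_flat.

Lemma Pi_flat_adjoint (R : realType) : adjoint (PiF R) (flatF R).
Proof.
exists (@flat_of_Pi R); split=> [X S|X X' S S' u v f].
  exists (@Pi_of_flat R X S) => [f|g].
    by apply: qus_hom_eq => c /=; rewrite piece_reprK.
  by apply: sss_hom_eq => x /=; rewrite flat_hom_piece.
by apply: sss_hom_eq => x /=; rewrite piece_mapE.
Qed.

(** * The adjunctions with the underlying quasi-universal space *)

Section flat_nat.
Variables (R : realType) (S : qus R) (X : sss R).

Lemma nat_of_flat_rv (f : sss_hom (flat_obj S) X) Y :
  rv S Y -> rv (nat_obj X) (f \o Y).
Proof. by move=> rY; apply: (sss_homP f (n := 0)); exact/flat_rv. Qed.

Lemma flat_of_nat_plot (g : qus_hom S (nat_obj X)) n p :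
  plot (flat_obj S) n p -> plot X n (g \o p).
Proof. by move=> [Y rY <-]; exact: plot_pi (qus_homP g rY). Qed.

End flat_nat.

Lemma flat_nat_adjoint (R : realType) : adjoint (flatF R) (natF R).
Proof.
exists (fun S X f => QUSHom (@nat_of_flat_rv R S X f)).
split=> [S X|S S' X X' u v f]; last exact: qus_hom_eq.
exists (fun g => SSSHom (@flat_of_nat_plot R S X g)) => f.
- exact: sss_hom_eq.
- exact: qus_hom_eq.
Qed.

Section nat_sharp.
Variables (R : realType) (X : sss R) (S : qus R).

Lemma sharp_of_nat_plot (f : qus_hom (nat_obj X) S) n p :
  plot X n p -> plot (sharp_obj S) n (f \o p).
Proof. by move=> pp h hh; exact: (qus_homP f (plot_rv0 (plot_comp pp hh))). Qed.

Lemma nat_of_sharp_rv (g : sss_hom X (sharp_obj S)) Y :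
  rv (nat_obj X) Y -> rv S (g \o Y).
Proof. by move=> rY; apply/sharp_rv; exact: (sss_homP g rY). Qed.

End nat_sharp.

Lemma nat_sharp_adjoint (R : realType) : adjoint (natF R) (sharpF R).
Proof.
exists (fun X S f => SSSHom (@sharp_of_nat_plot R X S f)).
split=> [X S|X X' S S' u v f]; last exact: sss_hom_eq.
exists (fun g => QUSHom (@nat_of_sharp_rv R X S g)) => f.
- exact: qus_hom_eq.
- exact: sss_hom_eq.
Qed.

(** * The right adjoint of the codiscrete functor *)

Section sharp_Lambda.
Variables (R : realType) (S : qus R) (X : sss R).

(** By the closure of random variables under precomposition, a random variable
is a morphism from Omega, and [sharp] makes it a sample-smooth map. *)
Lemma Lambda_of_sharp_rv (f : sss_hom (sharp_obj S) X) Y :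
  rv S Y -> rv (Lambda_obj X) (f \o Y).
Proof.
move=> rY.
pose Y' := @QUSHom R (qus_Omega R) S Y (fun Phi => rv_comp rY).
by exists (sss_comp f (sharp_map Y')).
Qed.

(** The retraction of Omega onto Omega_n turns [p] into the random variable
[p \o Omega_decode], which is all that [g] can be applied to; the plot
[Omega_code] then recovers [p]. *)
Lemma sharp_of_Lambda_plot (g : qus_hom S (Lambda_obj X)) n p :
  plot (sharp_obj S) n p -> plot X n (g \o p).
Proof.
move=> pp.
have [f gf] := qus_homP g (pp _ (Omega_decode_site R n)).
rewrite (_ : _ \o p = f \o @Omega_code R n).
  exact: sss_homP (@Omega_code_plot R n).
by apply/funext => tw; rewrite -gf /= Omega_codeK.
Qed.

End sharp_Lambda.

Lemma sharp_Lambda_adjoint (R : realType) : adjoint (sharpF R) (LambdaF R).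
Proof.
exists (fun S X f => QUSHom (@Lambda_of_sharp_rv R S X f)).
split=> [S X|S S' X X' u v f]; last exact: qus_hom_eq.
exists (fun g => SSSHom (@sharp_of_Lambda_plot R S X g)) => f.
- exact: sss_hom_eq.
- exact: qus_hom_eq.
Qed.

(** * Full faithfulness of the discrete and codiscrete functors *)

Lemma flat_full (R : realType) : full (flatF R).
Proof.
move=> S T g; unshelve eexists (@QUSHom R S T g _); last exact: sss_hom_eq.
by move=> Y rY; apply/(flat_rv 0); apply: (sss_homP g); exact/flat_rv.
Qed.

Lemma flat_faithful (R : realType) : faithful (flatF R).
Proof.
move=> S T f g fg; apply: qus_hom_eq => s.
exact: (congr1 (fun h : sss_hom (flat_obj S) (flat_obj T) => sss_fun h s) fg).
Qed.

Lemma sharp_full (R : realType) : full (sharpF R).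
Proof.
move=> S T g; unshelve eexists (@QUSHom R S T g _); last exact: sss_hom_eq.
by move=> Y rY; apply/sharp_rv; apply: (sss_homP g (n := 0)); exact/sharp_rv.
Qed.

Lemma sharp_faithful (R : realType) : faithful (sharpF R).
Proof.
move=> S T f g fg; apply: qus_hom_eq => s.
exact: (congr1 (fun h : sss_hom (sharp_obj S) (sharp_obj T) => sss_fun h s) fg).
Qed.

(** * Pieces of finite products *)

(** Two products of the same family are isomorphic over the projections, and a
functor preserves that isomorphism; so preservation of products has to be
checked on one product of each family only. *)
Lemma is_product_image (C D : category) (F : functor C D) (I : Type)
    (X : I -> C) (P P' : C) (pr : forall i, Defs.Hom P (X i))
    (pr' : forall i, Defs.Hom P' (X i)) :
  is_product pr -> is_product pr' ->
  is_product (X := fun i => F (X i)) (fun i => Defs.fmap F (pr' i)) ->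
  is_product (X := fun i => F (X i)) (fun i => Defs.fmap F (pr i)).
Proof.
move=> prP prP' FprP' Q f.
have [u [uE _]] := prP' P pr; have [v [vE _]] := prP P' pr'.
have vu : compc v u = idc P.
  have [w [_ wU]] := prP P pr.
  rewrite -(wU (compc v u)); first by apply: wU => i; exact: compc1r.
  by move=> i; rewrite compcA vE uE.
have [h [hE hU]] := FprP' Q f.
exists (compc (Defs.fmap F v) h); split=> [i|k kE].
  by rewrite compcA -fmapM vE hE.
rewrite (hU (compc (Defs.fmap F u) k)); first by rewrite compcA -fmapM vu fmap1 compc1l.
by move=> i; rewrite compcA -fmapM uE kE.
Qed.

Section Pi_products.
Variables (R : realType) (I : finType) (X : I -> sss R).

(** A chain of plots in [X i] is a chain in the product once the other
coordinates are held fixed, constants being plots. *)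
Lemma piece_equiv_dfwith (x : sss_prod X) (i : I) (a b : X i) :
  piece_equiv a b ->
  @piece_equiv R (sss_prod X) (dfwith x i a) (dfwith x i b).
Proof.
elim=> {a b} [_ _ [p [t [t' [w [pp -> ->]]]]]|a|a b _|a b c _ ab _ bc].
- apply: rst_step; exists (fun tw => dfwith x i (p tw)), t, t', w; split=> // j.
  have [ij|ij] := eqVneq i j.
    case: j / ij; rewrite (_ : (fun tw => _) = p) //.
    by apply/funext => tw; rewrite dfwithin.
  rewrite (_ : (fun tw => _) = cst (x j)); first exact: plot_cst.
  by apply/funext => tw; rewrite dfwithout.
- exact: rst_refl.
- exact: rst_sym.
- exact: rst_trans ab bc.
Qed.

(** Pass from [x] to [y] by replacing one coordinate after the other. It is here
that the index set must be finite. *)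
Lemma piece_equiv_prod (x y : sss_prod X) :
  (forall i, piece_equiv (x i) (y i)) -> piece_equiv x y.
Proof.
(* The mixture with the coordinates in [s] already replaced. *)
move=> xy; pose z (s : seq I) : sss_prod X := fun j => if j \in s then y j else x j.
suff zP s : piece_equiv x (z s).
  rewrite (_ : y = z (enum I)) //; apply/functional_extensionality_dep => j.
  by rewrite /z mem_enum.
elim: s => [|i s IHs]; first exact: rst_refl.
apply: rst_trans IHs _.
have -> : z s = dfwith (z s) i (z s i).
  by apply/functional_extensionality_dep => j; case: dfwithP.
have -> : z (i :: s) = dfwith (z s) i (y i).
  apply/functional_extensionality_dep => j; case: dfwithP => [|k ik].
    by rewrite /z mem_head.
  by rewrite /z inE eq_sym (negPf ik).
apply: piece_equiv_dfwith; rewrite /z; case: ifP => // _; exact: rst_refl.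
Qed.

(** Representatives of the components give the mediating map as a map of sets,
and [piece_equiv_prod] makes it independent of their choice; hence a random
variable may be lifted in each coordinate separately. *)
Lemma Pi_prodP : @is_product (QUSCat R) I (fun i => PiF R (X i))
  (PiF R (sss_prod X)) (fun i => Defs.fmap (PiF R) (sss_proj X i)).
Proof.
move=> Q f.
pose h (q : Q) : pieces (sss_prod X) :=
  @piece_proj R (sss_prod X) (fun i => piece_repr (f i q)).
have hE (q : Q) (x : sss_prod X) :
    (forall i, f i q = piece_proj (x i)) -> h q = piece_proj x.
  move=> fx; apply/piece_projP/piece_equiv_prod => i.
  by apply/piece_projP; exact: etrans (piece_reprK _) (fx i).
have hP Z : rv Q Z -> rv (Pi_obj (sss_prod X)) (h \o Z).
  move=> rZ.
  have /(_ _)/cid Y i : exists Y : Omega R -> X i,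
      rv (nat_obj (X i)) Y /\ @piece_proj R (X i) \o Y = f i \o Z.
    by have [Y rY YE] := qus_homP (f i) rZ; exists Y.
  exists (fun w i => sval (Y i) w).
    by move=> i; have [] := svalP (Y i).
  apply/funext => w /=; apply/esym/hE => i.
  by have [_ /(congr1 (fun g => g w))] := svalP (Y i).
exists (QUSHom hP); split=> [i|k kE].
  by apply: qus_hom_eq => q /=; rewrite (piece_mapE (sss_proj X i)) /= piece_reprK.
apply: qus_hom_eq => q /=; have [x xE] := piece_proj_surj (k q).
rewrite -xE; apply: hE => i.
by rewrite -(kE i) /= -xE (piece_mapE (sss_proj X i)).
Qed.

End Pi_products.

Lemma Pi_products (R : realType) : preserves_finite_products (PiF R).
Proof.
move=> I X P pr prP.
exact: (@is_product_image _ _ (PiF R) _ _ _ _ _ _ prP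
  (@sss_prodP R I X) (@Pi_prodP R I X)).
Qed.

(** * The adjoint string *)

Theorem theorem5p10 (R : realType) :
  [/\ adjoint (PiF R) (flatF R), adjoint (flatF R) (natF R),
      adjoint (natF R) (sharpF R) & adjoint (sharpF R) (LambdaF R)] /\
  [/\ full (flatF R), faithful (flatF R), full (sharpF R) & faithful (sharpF R)] /\
  preserves_finite_products (PiF R) /\
  cohesive_over (SSSCat R) (QUSCat R).
Proof.
have strings : [/\ adjoint (PiF R) (flatF R), adjoint (flatF R) (natF R) &
    adjoint (natF R) (sharpF R)].
  by split; [exact: Pi_flat_adjoint|exact: flat_nat_adjoint|exact: nat_sharp_adjoint].
have embeddings : [/\ full (flatF R), faithful (flatF R), full (sharpF R) &
    faithful (sharpF R)].
  split; [exact: flat_full|exact: flat_faithful|exact: sharp_full|].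
  exact: sharp_faithful.
have products := @Pi_products R.
split; first by case: strings => *; split=> //; exact: sharp_Lambda_adjoint.
do 2![split=> //].
by exists (PiF R), (flatF R), (natF R), (sharpF R).
Qed.
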